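(* Let $\theta_0\in\mathbb{R}^{n_\theta}$, let $\boldsymbol{\tau}^*$ be a solution of the parameterized optimal control problem for the fixed parameter $\theta=\theta_0$, let $\boldsymbol{\lambda}^*$ be Lagrange multipliers such that $\boldsymbol{z}^*=(\boldsymbol{\tau}^*,\boldsymbol{\lambda}^* )$ satisfies $\nabla_{\boldsymbol{z}}\mathcal{L}(\boldsymbol{z}^*,\theta_0)=0$, and assume that the Hessian $\mathcal{L}_{\boldsymbol{z}\boldsymbol{z}}(\boldsymbol{z}^*,\theta_0)$ is invertible. Let $\theta\mapsto\boldsymbol{z}^*(\theta)$ be the continuously differentiable function defined in a neighborhood of $\theta_0$ by the implicit function theorem, i.e. $\boldsymbol{z}^*(\theta_0)=\boldsymbol{z}^*$ and $\nabla_{\boldsymbol{z}}\mathcal{L}(\boldsymbol{z}^*(\theta),\theta)=0$. Let $L$ be a differentiable real-valued loss function of the trajectory $\boldsymbol{\tau}$, regarded as a function of $\boldsymbol{z}=(\boldsymbol{\tau},\boldsymbol{\lambda})$ that does not depend on $\boldsymbol{\lambda}$. Then the gradient at $\theta_0$ of $\theta\mapsto L(\boldsymbol{z}^*(\theta))$ is $$\nabla_\theta L(\boldsymbol{z}^*(\theta))\big|_{\theta=\theta_0}=\mathcal{L}_{\theta\boldsymbol{z}}\,\delta\boldsymbol{z},$$ where the vector $\delta\boldsymbol{z}$ is the solution of the linear system $$\mathcal{L}_{\boldsymbol{z}\boldsymbol{z}}\,\delta\boldsymbol{z}=-\nabla_{\boldsymbol{z}}L,$$ with $\mathcal{L}_{\theta\boldsymbol{z}}$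 and $\mathcal{L}_{\boldsymbol{z}\boldsymbol{z}}$ evaluated at $(\boldsymbol{z}^*,\theta_0)$ and $\nabla_{\boldsymbol{z}}L$ evaluated at $\boldsymbol{z}^*$.
   Context: Let $N,n_x,n_u,n_\theta$ be positive integers. The parameterized optimal control problem is, for $\theta\in\mathbb{R}^{n_\theta}$, $$\boldsymbol{\tau}^*(\theta)\in\arg\min_{\boldsymbol{\tau}}\ \sum_{k=0}^{N-1}\ell(x_k,u_k,\theta)+\phi(x_N,\theta)\quad\text{subject to } x_{k+1}=f(x_k,u_k,\theta)\ (k=0,\dots,N-1),\quad x_0=\xi(\theta),$$ where $\boldsymbol{\tau}=(x_0,u_0,x_1,u_1,\dots,x_N)$ with $x_k\in\mathbb{R}^{n_x}$, $u_k\in\mathbb{R}^{n_u}$; the functions $f:\mathbb{R}^{n_x}\times\mathbb{R}^{n_u}\times\mathbb{R}^{n_\theta}\to\mathbb{R}^{n_x}$, $\ell:\mathbb{R}^{n_x}\times\mathbb{R}^{n_u}\times\mathbb{R}^{n_\theta}\to\mathbb{R}$, $\phi:\mathbb{R}^{n_x}\times\mathbb{R}^{n_\theta}\to\mathbb{R}$ are twice continuously differentiable and $\xi:\mathbb{R}^{n_\theta}\to\mathbb{R}^{n_x}$ is continuously differentiable. The Lagrangian is $$\mathcal{L}(\boldsymbol{z},\theta)=\sum_{k=0}^{N-1}\Big(\ell(x_k,u_k,\theta)+\lambda_{k+1}^\top\big(f(x_k,u_k,\theta)-x_{k+1}\big)\Big)+\lambda_0^\top(\xi(\theta)-x_0)+\phi(x_N,\theta),$$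 with multipliers $\lambda_k\in\mathbb{R}^{n_x}$, $k=0,\dots,N$, and $\boldsymbol{z}=(\boldsymbol{\tau},\boldsymbol{\lambda})=(\lambda_0,x_0,u_0,\lambda_1,x_1,u_1,\dots,\lambda_N,x_N)$. Notation: $\mathcal{L}_{\boldsymbol{z}\boldsymbol{z}}=\partial_{\boldsymbol{z}}\nabla_{\boldsymbol{z}}\mathcal{L}$ is the Hessian in $\boldsymbol{z}$, $\mathcal{L}_{\boldsymbol{z}\theta}=\partial_\theta\nabla_{\boldsymbol{z}}\mathcal{L}$ is the matrix of mixed second partial derivatives, and $\mathcal{L}_{\theta\boldsymbol{z}}=\mathcal{L}_{\boldsymbol{z}\theta}^\top$. *)

(* Defs.v *)
From mathcomp Require Import all_boot all_order all_algebra.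
From mathcomp Require Import boolp classical_sets reals topology normedtype.
From mathcomp Require Import derive.

Set Implicit Arguments.
Unset Strict Implicit.
Unset Printing Implicit Defensive.
Import Order.TTheory GRing.Theory Num.Theory.
Import numFieldNormedType.Exports.

Local Open Scope ring_scope.
Local Open Scope classical_set_scope.

(* The topology on a space of linear maps is replaced by pointwise continuity
   of the differential in each direction; the two agree in finite dimension,
   the only case used here.  U is meant to be open. *)
Definition C1_on (R : realType) (V W : normedModType R) (U : set V)
    (g : V -> W) : Prop :=
  forall x, U x ->
    differentiable g x /\ forall v : V, {for x, continuous ('D_v g)}.

Definition C2 (R : realType) (V W : normedModType R) (g : V -> W) : Prop :=
  C1_on setT g /\ forall v : V, C1_on setT ('D_v g).

Definition grad (R : realType) (n : nat) (g : 'cV[R]_n -> R) (x : 'cV[R]_n) :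
    'cV[R]_n :=
  \col_i 'D_(delta_mx i 0) g x.

(* Rows are indexed by the components of G and columns by the variables, so
   this is the transpose of the library's 'J, which acts on row vectors. *)
Definition jac (R : realType) (m n : nat) (G : 'cV[R]_n -> 'cV[R]_m)
    (x : 'cV[R]_n) : 'M[R]_(m, n) :=
  \matrix_(i, j) 'D_(delta_mx j 0) (fun y => G y i 0) x.

(* tau = (x_0, u_0, ..., x_(N-1), u_(N-1), x_N) *)
Definition trajdim (N nx nu : nat) : nat := (\sum_(k < N) (nx + nu) + nx)%N.

(* z = (lambda_0, x_0, u_0, ..., lambda_(N-1), x_(N-1), u_(N-1),
        lambda_N, x_N) *)
Definition zdim (N nx nu : nat) : nat :=
  (\sum_(k < N) (nx + (nx + nu)) + (nx + nx))%N.

Section Problem.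
Context {R : realType} {N nx nu np : nat}.

Definition cur (k : 'I_N) : 'I_N.+1 := widen_ord (leqnSn N) k.
Definition next (k : 'I_N) : 'I_N.+1 := lift ord0 k.

Definition control (t : 'cV[R]_(trajdim N nx nu)) (k : 'I_N) : 'cV[R]_nu :=
  dsubmx (submxcol (usubmx t) k).

(* [unlift ord_max k] is [Some j] with j = k when k < N, and [None] when
   k = N. *)
Definition state (t : 'cV[R]_(trajdim N nx nu)) (k : 'I_N.+1) : 'cV[R]_nx :=
  if unlift ord_max k is Some j then usubmx (submxcol (usubmx t) j)
  else dsubmx t.

Definition zvec (t : 'cV[R]_(trajdim N nx nu)) (lam : 'I_N.+1 -> 'cV[R]_nx) :
    'cV[R]_(zdim N nx nu) :=
  col_mx
    (\mxcol_(k < N)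
       col_mx (lam (cur k)) (col_mx (state t (cur k)) (control t k)))
    (col_mx (lam ord_max) (state t ord_max)).

Definition ztraj (z : 'cV[R]_(zdim N nx nu)) : 'cV[R]_(trajdim N nx nu) :=
  col_mx (\mxcol_(k < N) dsubmx (submxcol (usubmx z) k)) (dsubmx (dsubmx z)).

Definition zmult (z : 'cV[R]_(zdim N nx nu)) (k : 'I_N.+1) : 'cV[R]_nx :=
  if unlift ord_max k is Some j then usubmx (submxcol (usubmx z) j)
  else usubmx (dsubmx z).

Lemma cur_lift (k : 'I_N) : cur k = lift ord_max k.
Proof. by apply/val_inj; rewrite /= /bump leqNgt ltn_ord. Qed.

Lemma ztraj_zvec t lam : ztraj (zvec t lam) = t.
Proof.
rewrite /ztraj /zvec col_mxKu !col_mxKd -[RHS]vsubmxK.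
congr col_mx; last by rewrite /state unlift_none.
apply/mxcolP => k.
by rewrite !mxcolK col_mxKd cur_lift /state liftK /control vsubmxK.
Qed.

Lemma zmult_zvec t lam : zmult (zvec t lam) = lam.
Proof.
apply/funext => k; rewrite /zmult /zvec.
case: unliftP => [j ->|->]; last by rewrite col_mxKd col_mxKu.
by rewrite col_mxKu mxcolK col_mxKu cur_lift.
Qed.

Lemma zvecK z : zvec (ztraj z) (zmult z) = z.
Proof.
rewrite /zvec -[RHS]vsubmxK; congr col_mx.
  apply/mxcolP => k; rewrite mxcolK.
  rewrite cur_lift /zmult /state liftK /control /ztraj col_mxKu mxcolK.
  by rewrite !vsubmxK.
by rewrite /zmult /state unlift_none /ztraj col_mxKd vsubmxK.
Qed.

Variables (f : 'cV[R]_nx * 'cV[R]_nu * 'cV[R]_np -> 'cV[R]_nx)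
  (l : 'cV[R]_nx * 'cV[R]_nu * 'cV[R]_np -> R)
  (phi : 'cV[R]_nx * 'cV[R]_np -> R) (xi : 'cV[R]_np -> 'cV[R]_nx).

Definition cost (theta : 'cV[R]_np) (t : 'cV[R]_(trajdim N nx nu)) : R :=
  \sum_(k < N) l (state t (cur k), control t k, theta)
  + phi (state t ord_max, theta).

Definition feasible (theta : 'cV[R]_np) (t : 'cV[R]_(trajdim N nx nu)) : Prop :=
  (forall k : 'I_N,
     state t (next k) = f (state t (cur k), control t k, theta))
  /\ state t ord0 = xi theta.

Definition solution (theta : 'cV[R]_np) (t : 'cV[R]_(trajdim N nx nu)) : Prop :=
  feasible theta t /\ forall t', feasible theta t' -> cost theta t <= cost theta t'.

Definition lagrangian (z : 'cV[R]_(zdim N nx nu)) (theta : 'cV[R]_np) : R :=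
  let x := state (ztraj z) in
  let u := control (ztraj z) in
  let lam := zmult z in
  \sum_(k < N)
     (l (x (cur k), u k, theta)
      + ((lam (next k))^T *m (f (x (cur k), u k, theta) - x (next k))) 0 0)
  + ((lam ord0)^T *m (xi theta - x ord0)) 0 0
  + phi (x ord_max, theta).

Definition lagr_z (z : 'cV[R]_(zdim N nx nu)) (theta : 'cV[R]_np) :
    'cV[R]_(zdim N nx nu) :=
  grad (fun z' => lagrangian z' theta) z.

Definition lagr_zz (z : 'cV[R]_(zdim N nx nu)) (theta : 'cV[R]_np) :
    'M[R]_(zdim N nx nu) :=
  jac (fun z' => lagr_z z' theta) z.

Definition lagr_ztheta (z : 'cV[R]_(zdim N nx nu)) (theta : 'cV[R]_np) :
    'M[R]_(zdim N nx nu, np) :=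
  jac (fun theta' => lagr_z z theta') theta.

(* Defined by transposition: xi is only C^1, so the Lagrangian need not be
   twice differentiable in theta first. *)
Definition lagr_thetaz (z : 'cV[R]_(zdim N nx nu)) (theta : 'cV[R]_np) :
    'M[R]_(np, zdim N nx nu) :=
  (lagr_ztheta z theta)^T.

End Problem.

(* Main.v *)
Require Import Defs.
From HB Require Import structures.
From mathcomp Require Import all_boot all_order all_algebra.
From mathcomp Require Import boolp classical_sets functions reals topology.
From mathcomp Require Import normedtype.
From mathcomp Require Import landau derive ring lra.

Set Implicit Arguments.
Unset Strict Implicit.
Unset Printing Implicit Defensive.
Import Order.TTheory GRing.Theory Num.Theory.
Import numFieldNormedType.Exports.

Local Open Scope ring_scope.
Local Open Scope classical_set_scope.

(** Write [F (z, theta)] for the Lagrangian, [Z] for the solution branch, [H] for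
    the Hessian of [F] in [z] and [B] for its mixed derivative, both at
    [(Z theta0, theta0)].  Differentiating the stationarity condition
    [grad_z F (Z theta, theta) = 0] along the branch gives [H *m Z' + B = 0]
    ([implicit_derivative]).  For a function [J] of [z], the chain rule says that
    the gradient of [J \o Z] is [Z'^T *m grad J].  If [H *m w = - grad J] then,
    [H] being symmetric,
    [Z'^T *m grad J = - Z'^T *m H *m w = - (H *m Z')^T *m w = B^T *m w]
    ([adjoint_gradient]): the linear system is solved once, whatever the number
    of parameters.

    Two analytic facts carry this.  The first is the symmetry of the Hessian,
    [deriveC], in the form due to Young: if [f] is differentiable and ['D_v f],
    ['D_w f] are differentiable at one point, the mixed derivatives there agree,
    because both are the limit of one symmetric second difference quotient
    ([cvg_second_diff]).

    The second is that the [z]-derivatives of the Lagrangian are differentiable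
    jointly in [(z, theta)], as the chain rule along [(Z theta, theta)] requires.
    The Lagrangian need not be twice differentiable jointly, since [xi] is only
    C^1, so the argument uses a regularity class relative to a set [D] of
    directions: differentiable functions whose derivatives in the directions of
    [D] are again differentiable ([twice_diff_along]).  It is closed under sums
    and products; with [D] the directions that leave [theta] fixed, it contains
    the C^2 functions of coordinates of [(z, theta)] and the components of
    [xi theta], out of which the Lagrangian is built
    ([lagrangian_twice_diff]). *)

(** * Symmetry of second derivatives *)

Section Young.
Context {R : realType} {V : normedModType R}.
Implicit Types (f : V -> R) (a v w : V).

Lemma derive_line f a v (t : R) :
  differentiable f (t *: v + a) ->
  is_derive t (1 : R) (fun s : R => f (s *: v + a)) ('D_v f (t *: v + a)).
Proof.
move=> df.
have dl : is_diff t (fun s : R => s *: v + a) (fun s => s *: v).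
  apply: is_diff_eq.
  by apply/funext => s; exact: addr0.
have dc : differentiable (fun s : R => f (s *: v + a)) t.
  by apply: (@differentiable_comp _ _ _ _ (fun s : R => s *: v + a) f).
apply: DeriveDef; first exact: diff_derivable.
rewrite deriveE // (@diff_comp _ _ _ _ (fun s : R => s *: v + a) f) //=.
by rewrite diff_val /= scale1r deriveE.
Qed.

Definition second_diff f a v w (h : R) : R :=
  f (h *: v + (h *: w + a)) - f (h *: v + a) - (f (h *: w + a) - f a).

Lemma second_diffC f a v w h : second_diff f a v w h = second_diff f a w v h.
Proof.
by rewrite /second_diff [X in f X - _](addrCA (h *: v)); ring.
Qed.

(** The mean value theorem for [s |-> f (s v + h w + a) - f (s v + a)], with [s]
    between [0] and [h], turns the second difference into [h] times an increment
    of ['D_v f] between two points at distance [O(h)] from [a], which differ by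
    [h w]; the first-order expansion of ['D_v f] at [a] evaluates that increment
    as [h * 'D_w ('D_v f) a + o(h)]. *)
Lemma cvg_second_diff f a v w :
  (forall x, differentiable f x) -> differentiable ('D_v f) a ->
  (h ^+ 2)^-1 * second_diff f a v w h @[h --> (0 : R)^'+]
    --> 'D_w ('D_v f) a.
Proof.
move=> df dg; set g := 'D_v f in dg *.
rewrite deriveE //.
apply/cvgrPdist_le => e e0.
(* For [0 < c < h] the norms of [c v] and [c v + h w] add up to less than
   [h * M]: the two expansion errors together are at most [e * h]. *)
pose M := 2 * `|v| + `|w| + 1.
have M0 : 0 < M by rewrite /M ltr_wpDl// addr_ge0// mulr_ge0.
have eM0 : 0 < e / M by rewrite divr_gt0.
have /diff_locally/eqaddoP/(_ _ eM0) := dg.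
rewrite /= => /nbhs_ballP[r /= r0 rg].
near=> h.
have h0 : 0 < h by near: h; exact: nbhs_right_gt.
have hr : h * M < r.
  rewrite -ltr_pdivlMr //; near: h; apply: nbhs_right_lt.
  exact: divr_gt0.
have gE y : `|y| <= h * M ->
    `|g (y + a) - (g a + 'd g a y)| <= e / M * `|y|.
  move=> yh; apply: rg; rewrite -ball_normE /= sub0r normrN.
  exact: le_lt_trans hr.
pose phi s := f (s *: v + (h *: w + a)) - f (s *: v + a).
have dphi t : is_derive t (1 : R) phi
    (g (t *: v + (h *: w + a)) - g (t *: v + a)).
  by apply: is_deriveB; exact: derive_line.
have [|c] := @MVT R phi
    (fun t => g (t *: v + (h *: w + a)) - g (t *: v + a)) 0 h h0
    (fun t _ => dphi t).
  apply: derivable_within_continuous => t _.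
  exact: (@ex_derive _ _ _ _ _ _ _ (dphi t)).
rewrite in_itv /= => /andP[c0 ch].
rewrite /phi !scale0r !add0r subr0 -/(second_diff f a v w h) => ->.
have cv : `|c *: v| <= h * `|v|.
  by rewrite normrZ gtr0_norm// ler_wpM2r// ltW.
have hw : `|h *: w| = h * `|w| by rewrite normrZ gtr0_norm.
have v0 := normr_ge0 v; have w0 := normr_ge0 w.
have cvM : `|c *: v| <= h * M.
  apply: (le_trans cv); rewrite ler_wpM2l ?ltW// /M; lra.
have cwv : `|c *: v + h *: w| <= h * (`|v| + `|w|).
  by rewrite mulrDr (le_trans (ler_normD _ _))// hw lerD2r.
have cwM : `|c *: v + h *: w| <= h * M.
  apply: (le_trans cwv); rewrite ler_wpM2l ?ltW// /M; lra.
have := gE _ cvM; have := gE _ cwM.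
have -> : 'd g a (c *: v + h *: w) = 'd g a (c *: v) + h *: 'd g a w :> R.
  by rewrite linearD; congr (_ + _); exact: linearZ.
rewrite -addrA.
set g1 : R := g (c *: v + (h *: w + a)); set g2 : R := g (c *: v + a).
set d1 : R := 'd g a (c *: v); set d2 : R := 'd g a w.
move=> E1 E2.
have -> : d2 - (h ^+ 2)^-1 * ((g1 - g2) * h) =
   - h^-1 * ((g1 - (g a + (d1 + h *: d2))) - (g2 - (g a + d1))).
  rewrite /GRing.scale /=; field; exact: lt0r_neq0.
rewrite normrM normrN normfV (gtr0_norm h0) mulrC ler_pdivrMr//.
apply: (le_trans (ler_normB _ _)); apply: (le_trans (lerD E1 E2)).
rewrite -mulrDr mulrAC ler_pdivrMr// -mulrA ler_pM2l//.
apply: (le_trans (lerD cwv cv)); rewrite -mulrDr ler_pM2l// /M; lra.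
Unshelve. all: by end_near. Qed.

(** Young's theorem: the second difference is symmetric in [v] and [w], and its
    quotient by [h ^+ 2] converges to each of the two sides. *)
Lemma deriveC f a v w :
  (forall x, differentiable f x) ->
  differentiable ('D_v f) a -> differentiable ('D_w f) a ->
  'D_w ('D_v f) a = 'D_v ('D_w f) a.
Proof.
move=> df dv dw.
have cvw := @cvg_second_diff f a w v df dw.
have cwv := @cvg_second_diff f a v w df dv.
have sC : second_diff f a v w = second_diff f a w v.
  by apply/funext => h; exact: second_diffC.
rewrite sC in cwv.
exact: cvg_unique cwv cvw.
Qed.

End Young.

(** * Functions with differentiable derivatives in given directions *)

(** Requiring [F] to be differentiable in all directions, not just along [D],
    makes the class closed under products: in ['D_v (F * G)] the factor [F]
    itself occurs. *)
Definition twice_diff_along (R : realType) (V : normedModType R) (D : set V)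
    (F : V -> R) : Prop :=
  (forall p, differentiable F p) /\
  forall v, D v -> forall p, differentiable ('D_v F) p.

Section TwiceDifferentiableAlong.
Context {R : realType} {V : normedModType R} {D : set V}.
Implicit Types (F G : V -> R).

Lemma twice_diff_alongD F G :
  twice_diff_along D F -> twice_diff_along D G -> twice_diff_along D (F + G).
Proof.
move=> [dF d2F] [dG d2G]; split=> [p|v Dv p]; first exact: differentiableD.
have -> : 'D_v (F + G) = 'D_v F + 'D_v G.
  by apply/funext => q; rewrite deriveD //; exact: diff_derivable.
by apply: differentiableD; [exact: d2F | exact: d2G].
Qed.

Lemma twice_diff_alongN F : twice_diff_along D F -> twice_diff_along D (- F).
Proof.
move=> [dF d2F]; split=> [p|v Dv p]; first exact: differentiableN.
have -> : 'D_v (- F) = - 'D_v F.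
  by apply/funext => q; rewrite deriveN //; exact: diff_derivable.
by apply: differentiableN; exact: d2F.
Qed.

Lemma twice_diff_alongM F G :
  twice_diff_along D F -> twice_diff_along D G -> twice_diff_along D (F * G).
Proof.
move=> [dF d2F] [dG d2G]; split=> [p|v Dv p]; first exact: differentiableM.
have -> : 'D_v (F * G) = F * 'D_v G + G * 'D_v F.
  by apply/funext => q; rewrite deriveM //; exact: diff_derivable.
apply: differentiableD; apply: differentiableM => //.
- exact: d2G.
- exact: d2F.
Qed.

Lemma twice_diff_along_sum n (F : 'I_n -> V -> R) :
  (forall i, twice_diff_along D (F i)) ->
  twice_diff_along D (fun p => \sum_(i < n) F i p).
Proof.
move=> dF; rewrite -fct_sumE; elim/big_ind : _ => // [|F' G'].
  split=> [p|v Dv p]; first exact: differentiable_cst.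
  have -> : 'D_v (0 : V -> R) = cst 0.
    by apply/funext => q; exact: derive_cst.
  exact: differentiable_cst.
exact: twice_diff_alongD.
Qed.

(** A map which is its own differential everywhere is linear and continuous;
    stated in this form, the property passes to pairs and compositions through
    the instances of [is_diff]. *)
Lemma twice_diff_along_C2_comp {W : normedModType R} (g : W -> R) (A : V -> W) :
  C2 g -> (forall p, is_diff p A A) -> twice_diff_along D (g \o A).
Proof.
move=> [dg d2g] dA.
have dA' p : differentiable A p by exact: (@ex_diff _ _ _ _ _ _ _ (dA p)).
split=> [p|v Dv p].
  by apply: differentiable_comp => //; have [] := dg (A p) I.
have -> : 'D_v (g \o A) = 'D_(A v) g \o A.
  apply/funext => q; have [dgq _] := dg (A q) I.
  rewrite /= !deriveE //; last exact: differentiable_comp.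
  by rewrite diff_comp //= (@diff_val _ _ _ _ _ _ _ (dA q)).
by apply: differentiable_comp => //; have [] := d2g (A v) (A p) I.
Qed.

Lemma twice_diff_along_linear (A : V -> R) :
  (forall p, is_diff p A A) -> twice_diff_along D A.
Proof.
move=> dA; split=> [p|v Dv p]; first exact: (@ex_diff _ _ _ _ _ _ _ (dA p)).
have -> : 'D_v A = cst (A v); last exact: differentiable_cst.
apply/funext => q; rewrite deriveE; last exact: (@ex_diff _ _ _ _ _ _ _ (dA q)).
by rewrite (@diff_val _ _ _ _ _ _ _ (dA q)).
Qed.

Lemma twice_diff_along_constant F :
  (forall p, differentiable F p) -> (forall v, D v -> 'D_v F = cst 0) ->
  twice_diff_along D F.
Proof.
move=> dF dF0; split=> // v Dv p; rewrite dF0 //; exact: differentiable_cst.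
Qed.

End TwiceDifferentiableAlong.

(** * Differentials and coordinates in finite dimension *)

Section FiniteDimensional.
Context {R : realType}.

Lemma cV_decomp n (v : 'cV[R]_n) : v = \sum_i v i 0 *: delta_mx i 0.
Proof. by rewrite [LHS]matrix_sum_delta; under eq_bigr do rewrite big_ord1. Qed.

(** Linear maps are continuous in finite dimension: they are finite sums of
    coordinates times fixed vectors. *)
Lemma is_diff_linear_cV n (W : normedModType R) (A : 'cV[R]_n -> W) p :
  linear A -> is_diff p A A.
Proof.
move=> linA; pose AM := GRing.isLinear.Build _ _ _ _ _ linA.
pose AL : {linear _ -> _} := HB.pack A AM.
have dA q : differentiable A q.
  have -> : A = \sum_(i < n) (fun z : 'cV[R]_n => z i 0 *: A (delta_mx i 0)).
    apply/funext => z; rewrite fct_sumE {1}(cV_decomp z).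
    by rewrite -[A]/(AL : _ -> _) linear_sum; under eq_bigr do rewrite linearZ.
  apply: differentiable_sum => i; apply: differentiableZl.
  exact: differentiable_coord.
apply: DiffDef => //; rewrite -[A]/(AL : _ -> _) diff_lin //.
by move=> q; apply: differentiable_continuous; exact: dA.
Qed.

Lemma is_diff_fst (V W : normedModType R) (p : V * W) : is_diff p fst fst.
Proof.
apply: DiffDef.
  by apply: (@linear_differentiable _ _ _ fst) => q; exact: cvg_fst.
by rewrite (@diff_lin _ _ _ fst) // => q; exact: cvg_fst.
Qed.

Lemma is_diff_snd (V W : normedModType R) (p : V * W) : is_diff p snd snd.
Proof.
apply: DiffDef.
  by apply: (@linear_differentiable _ _ _ snd) => q; exact: cvg_snd.
by rewrite (@diff_lin _ _ _ snd) // => q; exact: cvg_snd.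
Qed.

Lemma grad_dot n (g : 'cV[R]_n -> R) x v :
  differentiable g x -> 'D_v g x = \sum_i grad g x i 0 * v i 0.
Proof.
move=> dg; rewrite deriveE // {1}(cV_decomp v) linear_sum.
apply: eq_bigr => i _; rewrite linearZ mxE deriveE //=; exact: mulrC.
Qed.

Lemma jac_mul m n (G : 'cV[R]_n -> 'cV[R]_m) x v i :
  (forall i, differentiable (fun y => G y i 0) x) ->
  (jac G x *m v) i 0 = 'D_v (fun y => G y i 0) x.
Proof.
move=> dG; rewrite grad_dot // mxE; apply: eq_bigr => j _.
by rewrite !mxE.
Qed.

Lemma derive_fst (V W : normedModType R) (F : V * W -> R) v z theta :
  'D_v (fun z' => F (z', theta)) z = 'D_(v, 0) F (z, theta).
Proof.
rewrite /derive; apply: (congr1 (fun g : R -> R => lim (g @ 0^'))).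
apply/funext => h.
by rewrite /= -{1}(add0r theta) -{1}(scaler0 W h).
Qed.

Lemma derive_snd (V W : normedModType R) (F : V * W -> R) w z theta :
  'D_w (fun theta' => F (z, theta')) theta = 'D_(0, w) F (z, theta).
Proof.
rewrite /derive; apply: (congr1 (fun g : R -> R => lim (g @ 0^'))).
apply/funext => h.
by rewrite /= -{1}(add0r z) -{1}(scaler0 V h).
Qed.

End FiniteDimensional.

(** * Gradients through implicitly defined functions *)

Section Adjoint.
Context {R : realType} {n p : nat}.
Implicit Types (F : 'cV[R]_n * 'cV[R]_p -> R).

Definition fst_dirs : set ('cV[R]_n * 'cV[R]_p) := [set v | v.2 = 0].

Definition grad1 F (z : 'cV[R]_n) (theta : 'cV[R]_p) : 'cV[R]_n :=
  grad (fun z' => F (z', theta)) z.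

Definition hess11 F z theta : 'M[R]_n := jac (fun z' => grad1 F z' theta) z.

Definition hess12 F z theta : 'M[R]_(n, p) :=
  jac (fun theta' => grad1 F z theta') theta.

Lemma grad1E F z theta i :
  grad1 F z theta i 0 = 'D_(delta_mx i 0, 0) F (z, theta).
Proof. by rewrite mxE derive_fst. Qed.

Lemma hess11_sym F z theta :
  twice_diff_along fst_dirs F -> (hess11 F z theta)^T = hess11 F z theta.
Proof.
move=> [dF d2F]; apply/matrixP => i j; rewrite !mxE.
under eq_fun do rewrite grad1E.
under [in RHS]eq_fun do rewrite grad1E.
rewrite (derive_fst ('D_(delta_mx j 0, 0) F)).
rewrite (derive_fst ('D_(delta_mx i 0, 0) F)).
by apply: deriveC => //; apply: d2F.
Qed.

(** Along [P theta = (Z theta, theta)] each component of the partial gradient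
    vanishes, so its differential kills [('d Z theta0 v, v)]; splitting this
    vector as [('d Z theta0 v, 0) + (0, v)] gives the two blocks. *)
Lemma implicit_derivative F (Z : 'cV[R]_p -> 'cV[R]_n) theta0 v :
  twice_diff_along fst_dirs F -> differentiable Z theta0 ->
  (\forall theta \near theta0, grad1 F (Z theta) theta = 0) ->
  hess11 F (Z theta0) theta0 *m 'd Z theta0 v =
  - (hess12 F (Z theta0) theta0 *m v).
Proof.
move=> [dF d2F] dZ Z0; apply/colP => i; apply/eqP; rewrite [eqbRHS]mxE -addr_eq0.
pose G := 'D_(delta_mx i 0, 0) F.
have dG q : differentiable G q by exact: d2F.
have d1 j : differentiable (fun y => grad1 F y theta0 j 0) (Z theta0).
  under eq_fun do rewrite grad1E.
  apply: (@differentiable_comp _ _ _ _ (fun y => (y, theta0))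
    ('D_(delta_mx j 0, 0) F)).
    exact: differentiable_pair.
  exact: d2F.
have d2 j : differentiable (fun y => grad1 F (Z theta0) y j 0) theta0.
  under eq_fun do rewrite grad1E.
  apply: (@differentiable_comp _ _ _ _ (fun y => (Z theta0, y))
    ('D_(delta_mx j 0, 0) F)).
    exact: differentiable_pair.
  exact: d2F.
rewrite !jac_mul //.
under eq_fun do rewrite grad1E.
under [X in _ + 'D_v X _]eq_fun do rewrite grad1E.
rewrite (derive_fst G) (derive_snd G) !deriveE //.
pose P theta := (Z theta, theta).
have dP : differentiable P theta0 by exact: differentiable_pair.
have : 'D_v (G \o P) theta0 = 0.
  rewrite -(derive_cst (0 : R) theta0 v); apply: near_eq_derive.
  near=> theta.
  by rewrite /= /G /P -grad1E (near Z0 theta) // mxE.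
rewrite deriveE; last exact: differentiable_comp.
have isP : is_diff theta0 P (fun u => ('d Z theta0 u, u)).
  exact: is_diff_pair (differentiableP dZ) (is_diff_id theta0).
rewrite diff_comp //= (@diff_val _ _ _ _ _ _ _ isP) => <-.
rewrite -[X in X == _]linearD; apply/eqP; congr ('d G _ _).
by rewrite /GRing.add /= /add_pair /= addr0 add0r.
Unshelve. all: by end_near. Qed.

(** The symmetry of the Hessian moves it from the branch derivative ['d Z] onto
    the adjoint vector [w], where the linear system applies. *)
Lemma adjoint_gradient F (Z : 'cV[R]_p -> 'cV[R]_n) theta0
    (J : 'cV[R]_n -> R) w :
  twice_diff_along fst_dirs F -> differentiable Z theta0 ->
  (\forall theta \near theta0, grad1 F (Z theta) theta = 0) ->
  differentiable J (Z theta0) ->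
  hess11 F (Z theta0) theta0 *m w = - grad J (Z theta0) ->
  grad (J \o Z) theta0 = (hess12 F (Z theta0) theta0)^T *m w.
Proof.
move=> F2 dZ Z0 dJ Hw; apply/colP => j.
rewrite mxE deriveE; last exact: differentiable_comp.
rewrite diff_comp //= -deriveE // grad_dot //.
set dz := 'd Z theta0 _.
have -> : \sum_i grad J (Z theta0) i 0 * dz i 0 =
    ((grad J (Z theta0))^T *m dz) 0 0.
  by rewrite [RHS]mxE; apply: eq_bigr => i _; rewrite [in RHS]mxE.
rewrite -[grad J _]opprK -Hw linearN /= mulNmx trmx_mul hess11_sym // -mulmxA.
rewrite implicit_derivative // mulmxN opprK mulmxA -colE [LHS]mxE.
by rewrite -[w in RHS]trmxK -trmx_mul [RHS]mxE.
Qed.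

End Adjoint.

(** * The Lagrangian of the optimal control problem *)

Section Coordinates.
Context {R : realType} {N nx nu : nat}.
Implicit Types z : 'cV[R]_(zdim N nx nu).

Lemma state_ztraj_linear k : linear (fun z => state (ztraj z) k).
Proof.
move=> a y z; rewrite /state /ztraj; case: unliftP => [j _|_];
  by rewrite ?col_mxKu ?col_mxKd ?mxcolK; apply/matrixP => r c; rewrite !mxE.
Qed.

Lemma control_ztraj_linear k : linear (fun z => control (ztraj z) k).
Proof.
move=> a y z; rewrite /control /ztraj !col_mxKu !mxcolK.
by apply/matrixP => r c; rewrite !mxE.
Qed.

Lemma zmult_linear k : linear (fun z => zmult z k).
Proof.
by move=> a y z; rewrite /zmult; case: unliftP => [j _|_];
  apply/matrixP => r c; rewrite !mxE.
Qed.

Lemma ztraj_linear : linear (fun z => ztraj z).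
Proof.
move=> a y z; rewrite /ztraj scale_col_mx add_col_mx; congr col_mx.
  by apply/matrixP => r c; rewrite !mxE.
by apply/matrixP => r c; rewrite !mxE.
Qed.

End Coordinates.

Lemma C2_coord (R : realType) (V : normedModType R) m (g : V -> 'cV[R]_m) i :
  C2 g -> C2 (fun x => g x i 0).
Proof.
move=> [dg d2g].
have dcoord (h : V -> 'cV[R]_m) x : differentiable h x ->
    differentiable (fun x => h x i 0) x.
  move=> dh.
  apply: (@differentiable_comp _ _ _ _ h (fun y : 'cV_m => y i 0)) => //.
  exact: differentiable_coord.
have Dcoord (h : V -> 'cV[R]_m) v : (forall x, differentiable h x) ->
    'D_v (fun x => h x i 0) = fun x => 'D_v h x i 0.
  move=> dh; apply/funext => x; rewrite derive_mx ?mxE //.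
  exact: diff_derivable.
have C1coord (h : V -> 'cV[R]_m) : C1_on setT h ->
    C1_on setT (fun x => h x i 0).
  move=> dh x _; have [dhx cDh] := dh x I; split=> [|v]; first exact: dcoord.
  rewrite Dcoord; last by move=> y; have [] := dh y I.
  apply: (@continuous_comp _ _ _ ('D_v h) (fun y : 'cV_m => y i 0)) => //.
  exact: coord_continuous.
split=> [|v]; first exact: C1coord.
rewrite (Dcoord g v (fun x => (dg x I).1)).
exact: (C1coord _ (d2g v)).
Qed.

(** Only [xi] may lack second derivatives, and it depends on [theta] alone, hence
    is constant in the directions considered. *)
Lemma lagrangian_twice_diff (R : realType) (N nx nu np : nat)
  (f : 'cV[R]_nx * 'cV[R]_nu * 'cV[R]_np -> 'cV[R]_nx)
  (l : 'cV[R]_nx * 'cV[R]_nu * 'cV[R]_np -> R)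
  (phi : 'cV[R]_nx * 'cV[R]_np -> R)
  (xi : 'cV[R]_np -> 'cV[R]_nx) :
  C2 f -> C2 l -> C2 phi -> (forall theta, differentiable xi theta) ->
  twice_diff_along fst_dirs
    (fun q : 'cV[R]_(zdim N nx nu) * 'cV[R]_np =>
       lagrangian f l phi xi q.1 q.2).
Proof.
move=> f2 l2 phi2 xi1.
pose Q := ('cV[R]_(zdim N nx nu) * 'cV[R]_np)%type.
have linQ m (A : 'cV[R]_(zdim N nx nu) -> 'cV[R]_m) (q : Q) :
    linear A -> is_diff q (A \o fst) (A \o fst).
  by move=> linA; apply: is_diff_comp;
    [exact: is_diff_fst | exact: is_diff_linear_cV].
have coordQ m (A : 'cV[R]_(zdim N nx nu) -> 'cV[R]_m) i :
    linear A -> twice_diff_along fst_dirs (fun q : Q => A q.1 i 0).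
  move=> linA; apply: twice_diff_along_linear => q.
  have linAi : linear (fun z => A z i 0) by move=> a y z; rewrite linA !mxE.
  exact: is_diff_comp (is_diff_fst q) (is_diff_linear_cV q.1 linAi).
have xuthQ k (q : Q) : is_diff q
    (fun q : Q => (state (ztraj q.1) (cur k), control (ztraj q.1) k, q.2))
    (fun q : Q => (state (ztraj q.1) (cur k), control (ztraj q.1) k, q.2)).
  apply: is_diff_pair; last exact: is_diff_snd.
  apply: is_diff_pair.
    exact: (linQ _ _ q (state_ztraj_linear (cur k))).
  exact: (linQ _ _ q (control_ztraj_linear k)).
have xthQ (q : Q) : is_diff q
    (fun q : Q => (state (ztraj q.1) ord_max, q.2))
    (fun q : Q => (state (ztraj q.1) ord_max, q.2)).
  apply: is_diff_pair; last exact: is_diff_snd.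
  exact: (linQ _ _ q (state_ztraj_linear ord_max)).
have xiQ i : twice_diff_along fst_dirs (fun q : Q => xi q.2 i 0).
  apply: twice_diff_along_constant => [q|v v2].
    apply: (@differentiable_comp _ _ _ _ (fun q : Q => xi q.2)
      (fun y : 'cV_nx => y i 0)).
      apply: (@differentiable_comp _ _ _ _ (snd : Q -> _) xi) => //.
      exact: (@ex_diff _ _ _ _ _ _ _ (is_diff_snd q)).
    exact: differentiable_coord.
  apply/funext => -[z theta]; case: v v2 => dz w; rewrite /fst_dirs /= => ->.
  rewrite -(derive_fst (fun q : Q => xi q.2 i 0)) /=; exact: derive_cst.
rewrite /lagrangian; apply: twice_diff_alongD; first apply: twice_diff_alongD.
- apply: twice_diff_along_sum => k; apply: twice_diff_alongD.
    exact: (twice_diff_along_C2_comp l2 (xuthQ k)).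
  under eq_fun do rewrite mxE.
  apply: twice_diff_along_sum => i.
  under eq_fun do rewrite !mxE.
  apply: twice_diff_alongM; first exact: coordQ (zmult_linear _).
  apply: twice_diff_alongD.
    exact: (twice_diff_along_C2_comp (C2_coord i f2) (xuthQ k)).
  apply: twice_diff_alongN; exact: coordQ (state_ztraj_linear _).
- under eq_fun do rewrite mxE.
  apply: twice_diff_along_sum => i.
  under eq_fun do rewrite !mxE.
  apply: twice_diff_alongM; first exact: coordQ (zmult_linear _).
  apply: twice_diff_alongD; first exact: xiQ.
  apply: twice_diff_alongN; exact: coordQ (state_ztraj_linear _).
- exact: (twice_diff_along_C2_comp phi2 xthQ).
Qed.

Theorem theorem5 (R : realType) (N nx nu np : nat)
  (N_gt0 : (0 < N)%N) (nx_gt0 : (0 < nx)%N) (nu_gt0 : (0 < nu)%N)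
  (np_gt0 : (0 < np)%N)
  (f : 'cV[R]_nx * 'cV[R]_nu * 'cV[R]_np -> 'cV[R]_nx)
  (l : 'cV[R]_nx * 'cV[R]_nu * 'cV[R]_np -> R)
  (phi : 'cV[R]_nx * 'cV[R]_np -> R)
  (xi : 'cV[R]_np -> 'cV[R]_nx)
  (f_C2 : C2 f) (l_C2 : C2 l) (phi_C2 : C2 phi) (xi_C1 : C1_on setT xi)
  (theta0 : 'cV[R]_np)
  (taus : 'cV[R]_(trajdim N nx nu)) (lams : 'I_N.+1 -> 'cV[R]_nx)
  (taus_sol : solution f l phi xi theta0 taus)
  (zs_stat : lagr_z f l phi xi (zvec taus lams) theta0 = 0)
  (zs_inv : lagr_zz f l phi xi (zvec taus lams) theta0 \in unitmx)
  (U : set 'cV[R]_np) (U_open : open U) (U_theta0 : U theta0)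
  (zst : 'cV[R]_np -> 'cV[R]_(zdim N nx nu))
  (zst_C1 : C1_on U zst)
  (zst_theta0 : zst theta0 = zvec taus lams)
  (zst_stat : forall theta, U theta ->
     lagr_z f l phi xi (zst theta) theta = 0)
  (loss : 'cV[R]_(trajdim N nx nu) -> R)
  (loss_diff : forall t, differentiable loss t) :
  differentiable (fun theta => loss (ztraj (zst theta))) theta0 /\
  exists dz : 'cV[R]_(zdim N nx nu),
    unique (fun w : 'cV[R]_(zdim N nx nu) =>
              lagr_zz f l phi xi (zvec taus lams) theta0 *m w
              = - grad (fun z => loss (ztraj z)) (zvec taus lams)) dz
    /\ grad (fun theta => loss (ztraj (zst theta))) theta0
       = lagr_thetaz f l phi xi (zvec taus lams) theta0 *m dz.
Proof.
pose F (q : 'cV[R]_(zdim N nx nu) * 'cV[R]_np) := lagrangian f l phi xi q.1 q.2.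
have F2 : twice_diff_along fst_dirs F.
  by apply: lagrangian_twice_diff => // theta; have [] := xi_C1 theta I.
have [dzst _] := zst_C1 theta0 U_theta0.
have dJ z : differentiable (loss \o ztraj) z.
  apply: differentiable_comp => //.
  exact: (@ex_diff _ _ _ _ _ _ _ (is_diff_linear_cV z ztraj_linear)).
split; first exact: (@differentiable_comp _ _ _ _ zst (loss \o ztraj)).
set H := lagr_zz _ _ _ _ _ _ in zs_inv *; set b := - grad _ _.
exists (invmx H *m b); split.
  split=> [|w Hw]; first by rewrite mulKVmx.
  by rewrite -Hw mulKmx.
rewrite -zst_theta0.
apply: (@adjoint_gradient _ _ _ F zst theta0 (loss \o ztraj)) => //.
  near=> theta; apply: zst_stat; near: theta.
  exact: open_nbhs_nbhs.
by rewrite zst_theta0 mulKVmx.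
Unshelve. all: by end_near. Qed.
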